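(* Let $k$ be a finite field of characteristic $p$, let $l\neq p$ be a prime, and for $m\ge 1$ let $k_m$ denote the extension of $k$ of degree $m$. Let $n\geq 1$ and let $\phi=\psi\circ\mathrm{Norm}_{k_{ln}|k_n}$ be a regular character of $k_{ln}^*$ (regular with respect to $\mathrm{Gal}(k_{ln}/k_l)$), where $\psi$ is a regular character of $k_n^*$, so that $\phi$ induces a Frobenius-fixed cuspidal $l$-adic representation of $\mathrm{GL}_n(k_l)$. Let $\chi_n(\phi)$ be the character of this representation of $\mathrm{GL}_n(k_l)$, and let $\chi_n(\psi)$ be the character of the cuspidal $l$-adic representation of $\mathrm{GL}_n(k)$ induced by $\psi$. Then the reduction mod $l$ of $\chi_n(\phi)$, restricted to $\mathrm{GL}_n(k)$, coincides with the Frobenius twist of the reduction mod $l$ of $\chi_n(\psi)$; equivalently, $$\overline{\chi_n(\phi)(x)}=\overline{\chi_n(\psi)(x)}^{\,l}\qquad\text{for all } x\in\mathrm{GL}_n(k).$$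
   Context: Characters of tori take values in $\overline{\mathbb Z}_l^*$, where $\overline{\mathbb Z}_l$ is the integral closure of $\mathbb Z_l$ in $\overline{\mathbb Q}_l$. The bar denotes reduction modulo the maximal ideal of $\overline{\mathbb Z}_l$, with values in $\overline{\mathbb F}_l$; character values of $l$-adic representations lie in $\overline{\mathbb Z}_l$. For a finite field $\kappa$ of size $Q$ with degree $n$ extension $\kappa_n$, a character $\theta:\kappa_n^*\to\overline{\mathbb Z}_l^*$ is regular if its stabilizer in $\mathrm{Gal}(\kappa_n/\kappa)$ is trivial, i.e. $\theta,\theta^{Q},\dots,\theta^{Q^{n-1}}$ are pairwise distinct. To a regular $\theta$ is attached (Green, Springer) an irreducible cuspidal $l$-adic representation of $\mathrm{GL}_n(\kappa)$, with character $\chi_n(\theta)$; all irreducible cuspidal representations arise this way, and $\chi_n(\theta_1)=\chi_n(\theta_2)$ iff $\theta_1=\theta_2^{Q^i}$ for some $i$. Explicitly, $\chi_n(\theta)(x)=0$ unless the characteristic polynomial of $x$ is a power $f^{n/d}$ of an irreducible polynomial $f\in\kappa[T]$ of degree $d$; in that case, with $t\in\kappa_n^*$ a root of $f$ and $r=\frac1d\dim_\kappa\ker f(x)$, $$\chi_n(\theta)(x)=(-1)^{n-1}\Big(\sum_{i=0}^{d-1}\theta(t^{Q^i})\Big)\prod_{j=1}^{r-1}(1-Q^{dj}).$$ For $\chi_n(\phi)$ this is applied with $\kappa=k_l$ (so $\kappa_n=k_{ln}$), and for $\chi_n(\psi)$ with $\kappa=k$. A representation $\rho$ of $\mathrm{GL}_n(k_l)$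 is Frobenius-fixed if $\rho\cong\rho\circ\mathrm{Frob}_k$, where $\mathrm{Frob}_k$ acts entrywise by $x\mapsto x^{|k|}$. *)

(* Defs.v *)
From HB Require Import structures.
From mathcomp Require Import all_boot all_order all_algebra.
From mathcomp Require Import all_fingroup all_solvable all_field.
From mathcomp Require Import boolp classical_sets.

Set Implicit Arguments.
Unset Strict Implicit.
Unset Printing Implicit Defensive.

Import GRing.Theory.
Local Open Scope ring_scope.

Section PadicIntegers.
Local Open Scope nat_scope.

Variables (l : nat) (l_prime : prime l).

Definition padic_coherent (x : nat -> nat) : Prop :=
  forall n, x n = x n.+1 %% l ^ n.

(* The ring Z_l, as the inverse limit of the rings Z / l ^ n: the n-th term of
   a coherent sequence is the representative in [0, l ^ n[ of the class
   mod l ^ n. *)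
Definition padic_int of prime l := {x : nat -> nat | padic_coherent x}.

Local Notation Zl := (padic_int l_prime).

HB.instance Definition _ := gen_eqMixin Zl.
HB.instance Definition _ := gen_choiceMixin Zl.

Lemma padic_eq (x y : Zl) : sval x =1 sval y -> x = y.
Proof. by case: x y => x hx [y hy] /= /funext; apply: eq_exist. Qed.

Let l_gt0 : 0 < l. Proof. exact: prime_gt0. Qed.

Lemma padic_modn (x : Zl) n : sval x n %% l ^ n = sval x n.
Proof. by rewrite (proj2_sig x n) modn_mod. Qed.

Lemma padic_modnS (x : Zl) n : sval x n.+1 = sval x n %[mod l ^ n].
Proof. by rewrite padic_modn -(proj2_sig x n). Qed.

Lemma modn_expS a n : (a %% l ^ n.+1) %% l ^ n = a %% l ^ n.
Proof. by rewrite modn_dvdm // dvdn_exp2l. Qed.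

Fact padic_zero_subproof : padic_coherent (fun=> 0).
Proof. by move=> n; rewrite mod0n. Qed.
Definition padic_zero : Zl := exist _ _ padic_zero_subproof.

Fact padic_one_subproof : padic_coherent (fun n => 1 %% l ^ n).
Proof. by move=> n; rewrite modn_expS. Qed.
Definition padic_one : Zl := exist _ _ padic_one_subproof.

Fact padic_add_subproof (x y : Zl) :
  padic_coherent (fun n => (sval x n + sval y n) %% l ^ n).
Proof.
by move=> n; rewrite modn_expS -[RHS]modnDm !padic_modnS modnDm.
Qed.
Definition padic_add (x y : Zl) : Zl := exist _ _ (padic_add_subproof x y).

Fact padic_mul_subproof (x y : Zl) :
  padic_coherent (fun n => (sval x n * sval y n) %% l ^ n).
Proof.
by move=> n; rewrite modn_expS -[RHS]modnMm !padic_modnS modnMm.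
Qed.
Definition padic_mul (x y : Zl) : Zl := exist _ _ (padic_mul_subproof x y).

Lemma padic_lt (x : Zl) n : sval x n < l ^ n.
Proof. by rewrite (proj2_sig x n) ltn_pmod // expn_gt0 l_gt0. Qed.

Fact padic_opp_subproof (x : Zl) :
  padic_coherent (fun n => (l ^ n - sval x n) %% l ^ n).
Proof.
move=> n; rewrite modn_expS; apply/eqP.
rewrite -(eqn_modDr (sval x n)) subnK; last exact/ltnW/padic_lt.
rewrite -(modnDmr (_ - _)) -padic_modnS modnDmr subnK ?modnn; last exact/ltnW/padic_lt.
by rewrite expnS modnMl.
Qed.
Definition padic_opp (x : Zl) : Zl := exist _ _ (padic_opp_subproof x).

Fact padic_addA : associative padic_add.
Proof. by move=> x y z; apply: padic_eq => n /=; rewrite modnDml modnDmr addnA. Qed.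

Fact padic_addC : commutative padic_add.
Proof. by move=> x y; apply: padic_eq => n /=; rewrite addnC. Qed.

Fact padic_add0 : left_id padic_zero padic_add.
Proof. by move=> x; apply: padic_eq => n /=; rewrite add0n padic_modn. Qed.

Fact padic_addN : left_inverse padic_zero padic_opp padic_add.
Proof.
move=> x; apply: padic_eq => n /=.
by rewrite modnDml subnK ?modnn //; exact/ltnW/padic_lt.
Qed.

HB.instance Definition _ := GRing.isZmodule.Build Zl
  padic_addA padic_addC padic_add0 padic_addN.

Fact padic_mulA : associative padic_mul.
Proof. by move=> x y z; apply: padic_eq => n /=; rewrite modnMml modnMmr mulnA. Qed.

Fact padic_mulC : commutative padic_mul.
Proof. by move=> x y; apply: padic_eq => n /=; rewrite mulnC. Qed.

Fact padic_mul1 : left_id padic_one padic_mul.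
Proof. by move=> x; apply: padic_eq => n /=; rewrite modnMml mul1n padic_modn. Qed.

Fact padic_mulDl : left_distributive padic_mul padic_add.
Proof.
by move=> x y z; apply: padic_eq => n /=; rewrite modnMml modnDm mulnDl.
Qed.

Fact padic_one_neq0 : padic_one != padic_zero.
Proof.
apply/eqP => /(congr1 (fun x : Zl => sval x 1)) /=.
by rewrite expn1 modn_small ?prime_gt1.
Qed.

HB.instance Definition _ := GRing.Zmodule_isComNzRing.Build Zl
  padic_mulA padic_mulC padic_mul1 padic_mulDl padic_one_neq0.

Definition padic_unit : {pred Zl} := fun x => `[< exists y : Zl, (y * x)%R = 1%R >].
Definition padic_inv (x : Zl) : Zl := xget x [set y : Zl | (y * x)%R = 1%R].

Fact padic_mulV : {in padic_unit, left_inverse 1%R padic_inv *%R}.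
Proof. by move=> x /asboolP ex; exact: (xgetPex x ex). Qed.

Fact padic_unitP (x y : Zl) : (y * x)%R = 1%R -> padic_unit x.
Proof. by move=> yx1; apply/asboolP; exists y. Qed.

Fact padic_inv_out : {in [predC padic_unit], padic_inv =1 id}.
Proof.
move=> x /negP nux; apply: xgetPN => y /= yx1.
by apply: nux; exact: padic_unitP yx1.
Qed.

HB.instance Definition _ := GRing.ComNzRing_hasMulInverse.Build Zl
  padic_mulV padic_unitP padic_inv_out.

Lemma padic_mod_add (x : Zl) n m : sval x (n + m) = sval x n %[mod l ^ n].
Proof.
elim: m => [|m IHm]; first by rewrite addn0.
rewrite addnS -IHm -(modn_dvdm _ (dvdn_exp2l l (leq_addr m n))).
by rewrite padic_modnS modn_dvdm ?dvdn_exp2l ?leq_addr.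
Qed.

Lemma padic_neq0 (x : Zl) : (x != 0)%R ->
  exists n, forall m, ~~ (l ^ n %| sval x (n + m)).
Proof.
move=> xn0; have [n xn] : exists n, sval x n != 0.
  apply/not_existsP => x0; case/eqP: xn0; apply: padic_eq => n.
  by apply/eqP/negPn/negP; exact: x0.
by exists n => m; rewrite /dvdn padic_mod_add padic_modn.
Qed.

Fact padic_integral : GRing.integral_domain_axiom Zl.
Proof.
move=> x y xy0; apply/negPn/negP; rewrite negb_or => /andP[].
move=> /padic_neq0[n hx] /padic_neq0[m hy].
have {}hx := hx m; have := hy n; rewrite addnC => {}hy.
have := congr1 (fun z : Zl => sval z (n + m)) xy0; rewrite /= => /eqP.
rewrite -/(dvdn _ _); set a := sval x _ in hx *; set b := sval y _ in hy *.
have a0 : 0 < a by rewrite lt0n; apply: contraNneq hx => ->; rewrite dvdn0.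
have b0 : 0 < b by rewrite lt0n; apply: contraNneq hy => ->; rewrite dvdn0.
rewrite !pfactor_dvdn ?muln_gt0 ?a0 // in hx hy *.
rewrite lognM // leqNgt => /negP; apply.
by rewrite -ltnNge in hx; rewrite -ltnNge in hy; rewrite -addnS leq_add // ltnW.
Qed.

HB.instance Definition _ := GRing.ComUnitRing_isIntegral.Build Zl padic_integral.

End PadicIntegers.

Notation padic l_prime := {fraction (padic_int l_prime)}.

Section IntegralClosure.
Variables (l : nat) (l_prime : prime l) (K : closedFieldType).

(* As K is algebraically closed, this makes K an algebraic closure of Q_l. *)
Definition is_algebraic_closure (iota : padic l_prime -> K) : Prop :=
  forall z : K, algebraicOver iota z.

Variable iota : {rmorphism padic l_prime -> K}.

(* Integrality is over Z_l, not over its fraction field Q_l. *)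
Definition integral_pred of {rmorphism padic l_prime -> K} : pred K :=
  fun z => `[< integralOver (iota \o @FracField.tofrac (padic_int l_prime)) z >].

Fact integral_pred_subring : subring_closed (integral_pred iota).
Proof.
split=> [|x y /asboolP ix /asboolP iy|x y /asboolP ix /asboolP iy];
  apply/asboolP.
- exact: integral1.
- exact: integral_sub.
- exact: integral_mul.
Qed.

HB.instance Definition _ :=
  GRing.isSubringClosed.Build K (integral_pred iota) integral_pred_subring.

Definition integral_closure := {z : K | integral_pred iota z}.

HB.instance Definition _ := SubChoice.on integral_closure.
HB.instance Definition _ :=
  [SubChoice_isSubComNzRing of integral_closure by <:].

End IntegralClosure.

Section CuspidalCharacters.
(* The finite fields below are subfields U <= V of an extension L of a finite
   field k; thus #|U| = #|k| ^ \dim U. Characters of V^* are functions on L,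
   whose values outside of V^* are irrelevant. *)
Variables (k : finFieldType) (L : splittingFieldType k) (R : comNzRingType).
Implicit Types (U V : {subfield L}) (theta : L -> R).

(* As V^* is a group, theta takes its values in the units of R on V^*. *)
Definition mult_character V theta : Prop :=
  theta 1 = 1 /\
  {in V &, forall x y, x != 0 -> y != 0 -> theta (x * y) = theta x * theta y}.

Definition regular_character U V theta : Prop :=
  mult_character V theta /\
  (forall g : gal_of V, (g \in 'Gal(V / U))%g ->
     {in V, forall y, y != 0 -> theta (g y) = theta y} -> g = 1%g).

Variables (U V : {subfield L}) (theta : L -> R) (n : nat).

(* v is the value at x in GL_(n+1)(U) prescribed by an irreducible polynomial
   f, of degree d, and a root t of f in V^*. *)
Definition cuspidal_value (x : 'M[subvs_of U]_n.+1) (v : R) : Prop :=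
  exists (f : {poly subvs_of U}) (t : L),
    let Q := (#|k| ^ \dim U)%N in
    let d := (size f).-1 in
    let r := (\rank (kermx (horner_mx x f)) %/ d)%N in
    [/\ irreducible_poly f, char_poly x = f ^+ (n.+1 %/ d),
        (t \in V) && (t != 0), root (map_poly (vsval (U:=U)) f) t
      & v = (-1) ^+ n * (\sum_(i < d) theta (t ^+ (Q ^ i)))
              * \prod_(1 <= j < r) (1 - (Q ^ (d * j))%:R)].

(* The Green-Springer character of GL_(n+1)(U) attached to theta, for V of
   degree n+1 over U. The value does not depend on f (unique up to a scalar)
   nor on the root t (unique up to Gal(V / U)). *)
Definition cuspidal_character (x : 'M[subvs_of U]_n.+1) : R :=
  xget 0 [set v | cuspidal_value x v].

End CuspidalCharacters.

(* Main.v *)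
Require Import Defs.
From HB Require Import structures.
From mathcomp Require Import all_boot all_order all_algebra.
From mathcomp Require Import all_fingroup all_solvable all_field.
From mathcomp Require Import boolp.
From mathcomp Require classical_sets.

Set Implicit Arguments.
Unset Strict Implicit.
Unset Printing Implicit Defensive.

Import GRing.Theory.
Local Open Scope ring_scope.

(** Write q = #|k| and N = n+1. Let t be an element of k_N^* and let f be its
minimal polynomial over k, of degree d. When the characteristic polynomial of
x is a power of f, the value of either character at x is a sign, times a sum
of the character of the torus over d conjugates of t, times a product of terms
1 - Q^(dj), where Q is q^l for phi and q for psi. The congruence is the
Frobenius map a |-> a^l of Flbar, applied factor by factor to the value of
psi:
- on k_N the norm down from k_(lN) is y |-> y^l, so that phi(y) = psi(y)^l;
- the sum for phi runs over the t^(q^(li)), and as l is coprime to d these are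
  all the conjugates of t (eq_sum_coprime_reindex);
- integers are fixed by Frobenius, so the sign is unchanged and the l-th power
  of 1 - q^(dj) is 1 - q^(ldj) in Flbar.

Three facts make this work.

Flbar has characteristic l (residue_pchar): an inverse of l in Flbar would
lift to an integral z; multiplying the reduction of a monic equation of z by a
power of l shows that some element 1 + l a of Z_l, which is a unit, would
reduce to 0.

l is coprime to N (coprime_dim_of_regular_norm): if l divides N, then k_l lies
in k_N, and the nontrivial group Gal(k_(lN) / k_N) is contained in
Gal(k_(lN) / k_l) and fixes phi, which factors through the norm to k_N. This
contradicts the regularity of phi.

The vanishing conditions over k and over k_l agree, with the same roots t
(cuspidal_root_base_change). A polynomial irreducible over k of degree d
dividing N remains irreducible over k_l by coprimality. Conversely, let the
characteristic polynomial of x be m^M with m irreducible over k_l. It is fixed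
by Gal(k_(lN) / k), hence so is m, by unique factorization; so m has its
coefficients in k, its degree divides N, and its roots lie in k_N.

Since the Green-Springer value is specified by an arbitrary polynomial and an
arbitrary root of it, everything is first rewritten over the big field L in
terms of minimal polynomials (cuspidal_valueP), which removes the choice of the
polynomial; the choice of the root only shifts the sum over conjugates. *)

(** * The residue field has characteristic l *)

Section ResidueCharacteristic.
Variables (l : nat) (l_prime : prime l).
Local Notation Zl := (padic_int l_prime).

(** By Euler's theorem a power of the n-th term inverts it mod l ^ n; these
inverses are coherent because inverses mod l ^ n are unique. *)
Lemma padic_coprime_unit (a : Zl) :
  coprime (sval a 1%N) l -> a \is a GRing.unit.
Proof.
move=> a1_l; have l_gt0 := prime_gt0 l_prime.
have an_l n : coprime (sval a n) (l ^ n).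
  case: n => [|n]; first by rewrite expn0 coprimen1.
  have := padic_mod_add a 1 n; rewrite add1n expn1 => a1.
  by rewrite coprimeXr // -coprime_modl a1 coprime_modl.
pose b n := (sval a n ^ (totient (l ^ n)).-1 %% l ^ n)%N.
have ab n : (sval a n * b n = 1 %[mod l ^ n])%N.
  rewrite modnMmr -expnS prednK ?totient_gt0 ?expn_gt0 ?l_gt0 //.
  exact: Euler_exp_totient.
have coherent_b : padic_coherent l b.
  move=> n; have abS : (sval a n * b n.+1 = 1 %[mod l ^ n])%N.
    rewrite -modnMml -padic_modnS modnMml -modn_expS ab modn_expS.
    by [].
  have -> : b n = (b n %% l ^ n)%N by rewrite modn_mod.
  rewrite -[in LHS](mul1n (b n)) -modnMml -abS modnMml mulnAC.
  by rewrite -modnMml ab modnMml mul1n.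
apply/asboolP; exists (exist _ b coherent_b); apply: padic_eq => n /=.
by rewrite mulnC ab.
Qed.

Lemma padic_nat m n : sval (m%:R : Zl) n = (m %% l ^ n)%N.
Proof.
by elim: m => [|m IHm]; rewrite ?mod0n // mulrS /= IHm modnDm add1n.
Qed.

Lemma padic_l_mul_add1_unit (a : Zl) : l%:R * a + 1 \is a GRing.unit.
Proof.
apply: padic_coprime_unit; rewrite /= padic_nat expn1 modnn mul0n mod0n.
by rewrite add0n modn_mod coprime_modl coprime1n.
Qed.

Variables (K : closedFieldType) (iota : {rmorphism padic l_prime -> K}).

Fact padic_integral_subproof (a : Zl) :
  integral_pred iota iota (iota (FracField.tofrac a)).
Proof.
by apply/asboolP; apply: (integral_id (iota \o @FracField.tofrac Zl)).
Qed.

Definition padic_to_closure (a : Zl) : integral_closure iota :=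
  exist (fun z => integral_pred iota iota z) _ (padic_integral_subproof a).

Fact padic_to_closure_zmod : zmod_morphism padic_to_closure.
Proof. by move=> a b; apply: val_inj; rewrite /= !rmorphB. Qed.

Fact padic_to_closure_monoid : monoid_morphism padic_to_closure.
Proof.
by split=> [|a b]; apply: val_inj; rewrite /= ?rmorph1 ?rmorphM.
Qed.

HB.instance Definition _ :=
  GRing.isZmodMorphism.Build Zl (integral_closure iota)
    padic_to_closure padic_to_closure_zmod.
HB.instance Definition _ :=
  GRing.isMonoidMorphism.Build Zl (integral_closure iota)
    padic_to_closure padic_to_closure_monoid.

(** Were l invertible in F, its inverse would be the image of some integral z.
Multiplying the reduction of a monic equation of degree m for z by l ^ m turns
it into the vanishing of an element of 1 + l Z_l, a unit. *)
Lemma residue_pchar (F : fieldType)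
    (red : {rmorphism integral_closure iota -> F}) :
  (forall a, exists z, red z = a) -> l \in [pchar F].
Proof.
move=> red_surj; rewrite inE l_prime /=; apply: contraT => l_neq0.
have [z red_z] := red_surj (l%:R^-1).
have /asboolP[P monP Pz0] := valP z.
have {}Pz0 : root (map_poly padic_to_closure P) z.
  apply/rootP/val_inj; rewrite rmorph0 -[LHS](horner_map val) -map_poly_comp.
  exact: (rootP Pz0).
have : root (map_poly red (map_poly padic_to_closure P)) (l%:R^-1).
  by rewrite -red_z rmorph_root.
pose j : {rmorphism Zl -> F} := red \o padic_to_closure.
rewrite -map_poly_comp -[red \o _]/(j : Zl -> F) => /rootP.
set m := (size P).-1.
have sizeP : size P = m.+1 by rewrite prednK // size_poly_gt0 monic_neq0.
rewrite horner_coef => /(congr1 ( *%R (l%:R ^+ m))).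
rewrite mulr0 size_map_poly_id0; last first.
  by rewrite (monicP monP) rmorph1 oner_neq0.
rewrite mulr_sumr.
(* b is l ^ m * P(1 / l), rid of denominators; its last term comes from the
   leading coefficient of P. *)
pose b : Zl := \sum_(i < m) P`_i * l%:R ^+ (m - i) + 1.
have -> :
  \sum_(i < size P) l%:R ^+ m * ((map_poly j P)`_i * l%:R^-1 ^+ i) = j b.
  rewrite sizeP big_ord_recr rmorphD rmorph_sum /= !coef_map /=.
  have -> : P`_m = 1 by rewrite -(monicP monP).
  congr (_ + _); last by rewrite !rmorph1 mul1r exprVn divff ?expf_neq0.
  apply: eq_bigr => i _.
  rewrite coef_map /= mulrCA !rmorphM !rmorphXn !rmorph_nat.
  by congr (_ * _); rewrite exprVn expfB.
have /mulVr/(congr1 j) : b \is a GRing.unit.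
  have -> : b = l%:R * (\sum_(i < m) P`_i * l%:R ^+ (m - i).-1) + 1.
    rewrite /b mulr_sumr; congr (_ + _); apply: eq_bigr => i _.
    by rewrite mulrCA -exprS prednK ?subn_gt0.
  exact: padic_l_mul_add1_unit.
rewrite rmorphM rmorph1 => bV b0; move: bV.
by rewrite b0 mulr0 => /esym/eqP; rewrite oner_eq0.
Qed.
End ResidueCharacteristic.

(** * Sums over a cyclic index set *)

Lemma eq_sum_coprime_reindex (A : nmodType) (F : nat -> A) (d c j : nat) :
  (0 < d)%N -> coprime c d -> (forall i, F (i %% d)%N = F i) ->
  \sum_(i < d) F (j + c * i)%N = \sum_(i < d) F i.
Proof.
case: d => // d _ cd periodic.
pose h (i : 'I_d.+1) : 'I_d.+1 := inord ((j + c * i) %% d.+1).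
have hE i : h i = ((j + c * i) %% d.+1)%N :> nat by rewrite inordK ?ltn_pmod.
have h_inj : injective h.
  move=> a b /(congr1 val); rewrite /= !hE => /eqP; rewrite eqn_modDl => e.
  apply: val_inj => /=; wlog le_ab : a b e / (b <= a)%N.
    move=> W; case: (leqP b a) => [|/ltnW] le; first exact: W.
    by apply/esym/W; rewrite // eq_sym.
  move: e; rewrite eqn_mod_dvd ?leq_mul // -mulnBr Gauss_dvdr 1?coprime_sym //.
  move=> dvd; apply/eqP; rewrite eqn_leq le_ab andbT -subn_eq0.
  by move: dvd; apply: contraLR; rewrite -lt0n => /gtnNdvd-> //;
     rewrite ltnS leq_subLR (leq_trans (_ : a <= d)%N) ?leq_addl // -ltnS.
by rewrite [RHS](reindex_inj h_inj) /=; apply: eq_bigr => i _;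
  rewrite hE periodic.
Qed.

(** * Subfields and minimal polynomials over a finite field *)

Section FiniteFields.
Variables (k : finFieldType) (L : splittingFieldType k).
Implicit Types (F K E U V : {subfield L}) (s t y : L).

Lemma expf_iter_id (q a b : nat) y : y ^+ (q ^ a) = y -> y ^+ (q ^ (a * b)) = y.
Proof.
move=> ya; elim: b => [|b IHb]; first by rewrite muln0 expr1.
by rewrite mulnS expnD exprM ya.
Qed.

(** A subfield of dimension m over k is the set of solutions of
y ^ (#|k| ^ m) = y, so inclusion of subfields is divisibility of dimensions. *)
Lemma subv_dvd_dim K E : (\dim K %| \dim E)%N -> (K <= E)%VS.
Proof.
move=> /dvdnP[c dimE]; apply/subvP => y; rewrite !Fermat's_little_theorem.
by move=> /eqP yK; rewrite dimE mulnC expf_iter_id.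
Qed.

Lemma finField_gal_mem K (g : gal_of {:L}) y :
  y \in K -> g y \in K.
Proof.
by rewrite !Fermat's_little_theorem -rmorphXn => /eqP->.
Qed.

(** The roots of minPoly F t are the images of t under Gal(L / F), which the
#|F|-power map generates. *)
Lemma minPoly_conj F t s :
  root (minPoly F t) s -> exists j, s = t ^+ ((#|k| ^ \dim F) ^ j).
Proof.
move=> ts; have galF := finField_galois (subvf F).
have /and3P[_ _ normF] := galF.
have [g g_gal <-] := normalField_root_minPoly (subvf F) normF (memvf t) ts.
have [a /eqP gen_a aE] := finField_galois_generator (subvf F).
move: g_gal; rewrite gen_a => /cycleP[j ->]; exists j.
elim: j => [|j IHj]; first by rewrite expr1 gal_id.
by rewrite expgSr galM ?memvf // IHj aE ?memvf // expnSr exprM.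
Qed.

Lemma eq_minPoly F K s : 
  (F <= K)%VS -> (adjoin_degree F s <= adjoin_degree K s)%N ->
  minPoly K s = minPoly F s.
Proof.
move=> sFK le_d; have dvd := minPolyS s sFK.
apply/eqP; rewrite -eqp_monic ?monic_minPoly // -(dvdp_size_eqp dvd).
rewrite eqn_leq (dvdp_leq _ dvd) ?monic_neq0 ?monic_minPoly //.
by rewrite !size_minPoly ltnS.
Qed.

(** The degree of F(s) over F divides [K(s) : F] = [K(s) : K] [K : F], hence
divides [K(s) : K] if it is prime to [K : F]: the degree of s does not drop. *)
Lemma minPoly_coprime F K s : (F <= K)%VS ->
  coprime (adjoin_degree F s) (\dim_F K) -> minPoly K s = minPoly F s.
Proof.
move=> sFK cop; apply: eq_minPoly => //; apply: dvdn_leq => //.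
have : (<<F; s>> <= <<K; s>>)%VS by apply: adjoinSl.
move/field_dimS; rewrite !dim_Fadjoin [\dim K](dim_sup_field sFK).
by rewrite mulnA dvdn_pmul2r ?adim_gt0 // Gauss_dvdl.
Qed.

(** A Galois automorphism over F preserves the finite field K and the power, so
it maps minPoly K s to a monic polynomial over K of the same degree which still
vanishes at s, that is, to itself. *)
Lemma minPoly_descent F K s M : (F <= K)%VS -> (0 < M)%N ->
  minPoly K s ^+ M \is a polyOver F -> minPoly K s = minPoly F s.
Proof.
move=> sFK M_gt0 mM_F; set m := minPoly K s.
have gm (g : gal_of {:L}) : g \in 'Gal({:L} / F)%g -> map_poly g m = m.
  move=> gF; have gmM : map_poly g m ^+ M = m ^+ M.
    by rewrite -rmorphXn; exact: (fixedPoly_gal (subvf F)).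
  have gm_K : map_poly g m \is a polyOver K.
    apply/polyOverP => i; rewrite coef_map; apply: finField_gal_mem => //.
    exact/polyOverP/minPolyOver.
  have /(minPoly_dvdp gm_K) dvd : root (map_poly g m) s.
    have : root (map_poly g m ^+ M) s by rewrite gmM root_exp //;
      [exact: root_minPoly | exact: mulrC].
    by rewrite root_exp //; exact: mulrC.
  apply/esym/eqP; rewrite -eqp_monic ?map_monic ?monic_minPoly //.
  by rewrite -(dvdp_size_eqp dvd) size_map_poly.
have m_F : m \is a polyOver F.
  apply/polyOverP => i.
  rewrite -(galois_fixedField (finField_galois (subvf F))).
  apply/fixedFieldP; first exact: memvf.
  by move=> g /gm {2}<-; rewrite coef_map.
apply/eqP; rewrite -eqp_monic ?monic_minPoly // /eqp minPolyS //=.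
by apply: minPoly_dvdp; rewrite ?root_minPoly.
Qed.

Lemma galNorm_base K E y :
  galois K E -> y \in K -> galNorm K E y = y ^+ (\dim_K E).
Proof.
move=> galKE Ky; have /and3P[sKE _ _] := galKE.
rewrite (galois_dim galKE) -prodr_const; apply: eq_bigr => g gG.
exact: (fixed_gal sKE).
Qed.

(** As \dim U is prime, failure of coprimality means that U is contained in V;
then Gal(L / V), which is nontrivial and preserves the norm to V, is contained
in Gal(L / U) and fixes phi. *)
Lemma coprime_dim_of_regular_norm (R : comNzRingType) U V
    (phi psi : L -> R) :
  prime (\dim_V {:L}) -> \dim U = \dim_V {:L} ->
  regular_character U {:L}%AS phi ->
  (forall y, y != 0 -> phi y = psi (galNorm V {:L} y)) ->
  coprime (\dim U) (\dim V).
Proof.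
move=> l_prime dimU [_ phi_reg] phiE; rewrite dimU prime_coprime //.
apply/negP; rewrite -dimU => /subv_dvd_dim sUV.
have galV := finField_galois (subvf V).
have trivial : 'Gal({:L} / V)%g \subset [1]%g.
  apply/subsetP => g gV; rewrite inE; apply/eqP/phi_reg.
    by apply: subsetP gV; exact: galS.
  by move=> y _ y0; rewrite !phiE ?fmorph_eq0 // galNorm_gal ?memvf.
have := subset_leq_card trivial; rewrite cards1 -(galois_dim galV).
by rewrite leqNgt prime_gt1.
Qed.

End FiniteFields.

(** * Values of cuspidal characters in terms of minimal polynomials *)

Section CuspidalValues.
Variables (k : finFieldType) (L : splittingFieldType k) (n : nat).
Variable x : 'M[k]_n.+1.
Implicit Types (U V : {subfield L}) (s t : L).

Let xL : 'M[L]_n.+1 := map_mx (in_alg L) x.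

Definition cuspidal_root U V t : Prop :=
  [/\ t \in V, t != 0
    & char_poly xL = minPoly U t ^+ (n.+1 %/ adjoin_degree U t)].

Definition cuspidal_value_at U (R : comNzRingType) (theta : L -> R) t : R :=
  let Q := (#|k| ^ \dim U)%N in
  let d := adjoin_degree U t in
  let r := (\rank (kermx (horner_mx xL (minPoly U t))) %/ d)%N in
  (-1) ^+ n * (\sum_(i < d) theta (t ^+ (Q ^ i)))
    * \prod_(1 <= j < r) (1 - (Q ^ (d * j))%:R).

Lemma map_subvs_in_alg U : map_mx vsval (map_mx (in_alg (subvs_of U)) x) = xL.
Proof. by apply/matrixP => i j; rewrite !mxE /= algid1. Qed.

(** With minPoly_irreducible, this makes minimal polynomials stand for all the
irreducible polynomials over U which have a root in L. *)
Lemma irreducible_minPoly U t (f : {poly subvs_of U}) :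
  irreducible_poly f -> root (map_poly vsval f) t ->
  exists2 c, c != 0 & map_poly vsval f = c *: minPoly U t.
Proof.
move=> [_ irr_f] ft; have /polyOver_subvs[g gE] := minPolyOver U t.
have : minPoly U t %| map_poly vsval f.
  by apply: minPoly_dvdp => //; apply/polyOver_subvs; exists f.
rewrite gE dvdp_map => /irr_f; rewrite -(size_map_poly vsval) -gE.
rewrite size_minPoly gtn_eqF ?ltnS // => /(_ isT).
rewrite -(eqp_map (vsval : {rmorphism subvs_of U -> L})) -gE.
move=> /eqpf_eq[c c0 mE].
by exists c^-1; rewrite ?invr_eq0 // mE scalerA mulVf ?scale1r.
Qed.

Lemma minPoly_irreducible U t :
  exists2 f : {poly subvs_of U}, irreducible_poly f
    & minPoly U t = map_poly vsval f.
Proof.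
have /polyOver_subvs[f fE] := minPolyOver U t; exists f => //.
split=> [|g size_g]; first by rewrite -(size_map_poly vsval) -fE size_minPoly.
rewrite -(dvdp_map (vsval : {rmorphism subvs_of U -> L})) -fE => g_dvd.
have /minPoly_irr : map_poly vsval g \is a polyOver U.
  by apply/polyOver_subvs; exists g.
move=> /(_ t g_dvd); rewrite fE eqp_map => /orP[//|].
by rewrite -size_poly_eq1 size_map_poly (negbTE size_g).
Qed.

Lemma degree_rank_minPoly_scale U t c
    (f : {poly subvs_of U}) (xU := map_mx (in_alg (subvs_of U)) x) :
  c != 0 -> map_poly vsval f = c *: minPoly U t ->
  (size f).-1 = adjoin_degree U t /\
  \rank (kermx (horner_mx xU f)) = \rank (kermx (horner_mx xL (minPoly U t))).
Proof.
move=> c0 fE; split.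
  by rewrite -(size_map_poly vsval) fE size_scale // size_minPoly.
rewrite !mxrank_ker -(mxrank_map vsval (horner_mx xU f)) map_horner_mx.
by rewrite map_subvs_in_alg fE linearZ mxrank_scale_nz.
Qed.

(** The irreducible polynomials over U with root t are the nonzero multiples of
minPoly U t, and neither the degree nor the rank of the kernel sees the
scalar. Moving to L puts the values for different U on the same matrix. *)
Lemma cuspidal_valueP U V (R : comNzRingType) (theta : L -> R) v :
  cuspidal_value V theta (map_mx (in_alg (subvs_of U)) x) v <->
  exists2 t, cuspidal_root U V t & v = cuspidal_value_at U theta t.
Proof.
split=> [[f [t [irr_f]]] | [t [Vt t0 charE] ->]].
- move=> charE /andP[Vt t0] ft ->; exists t.
  + split=> //; rewrite -(map_subvs_in_alg U) -map_char_poly charE rmorphXn /=.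
    have [c c0 fE] := irreducible_minPoly irr_f ft.
    have := char_poly_monic (map_mx vsval (map_mx (in_alg (subvs_of U)) x)).
    rewrite -map_char_poly charE rmorphXn /= fE exprZn monicE lead_coefZ.
    have -> : (size f).-1 = adjoin_degree U t.
      by have [->] := degree_rank_minPoly_scale c0 fE.
    by rewrite (monicP (monic_exp _ (monic_minPoly U t))) mulr1 => /eqP->;
      rewrite scale1r.
  + have [c c0 fE] := irreducible_minPoly irr_f ft.
    by rewrite /cuspidal_value_at; have [-> ->] := degree_rank_minPoly_scale c0 fE.
- have [f irr_f fE] := minPoly_irreducible U t; exists f, t.
  have := fE; rewrite -(scale1r (minPoly U t)) => /esym fE1.
  have [-> ->] := degree_rank_minPoly_scale (oner_neq0 L) fE1.
  split=> //; last by rewrite -fE root_minPoly.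
  + apply: (map_poly_inj (vsval : {rmorphism subvs_of U -> L})).
    by rewrite map_char_poly map_subvs_in_alg charE rmorphXn /= -fE.
  + by rewrite Vt.
Qed.

(** * Comparison of the values over k and over its extension U *)

Lemma char_poly_polyOver1 : char_poly xL \is a polyOver 1%VS.
Proof. by apply/polyOver1P; exists (char_poly x); rewrite map_char_poly. Qed.

Lemma cuspidal_root_exp_gt0 U V t :
  cuspidal_root U V t -> (0 < n.+1 %/ adjoin_degree U t)%N.
Proof.
case=> _ _ charE; rewrite lt0n; apply/eqP => M0.
by have := size_char_poly xL; rewrite charE M0 expr0 size_poly1.
Qed.

(** The quotient n.+1 %/ d is truncated; that it is exact follows from the
degree of the characteristic polynomial. *)
Lemma cuspidal_root_degree U V t :
  cuspidal_root U V t -> (adjoin_degree U t %| n.+1)%N.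
Proof.
case=> _ _ charE; apply/dvdnP; exists (n.+1 %/ adjoin_degree U t)%N.
have := size_char_poly xL; rewrite charE => /(congr1 predn) /=.
by rewrite size_exp size_minPoly /= mulnC.
Qed.

Lemma adjoin_degree_minPoly U U' s t :
  minPoly U s = minPoly U' t -> adjoin_degree U s = adjoin_degree U' t.
Proof. by move=> mE; apply: succn_inj; rewrite -!size_minPoly mE. Qed.

Lemma minPoly_coprime_dim U V t :
  coprime (\dim U) (\dim V) -> t \in V -> minPoly U t = minPoly 1 t.
Proof.
move=> cop Vt; apply: minPoly_coprime; first exact: sub1v.
rewrite coprime_sym dimv1 divn1; apply: coprime_dvdr cop.
have : (<<1; t>> <= V)%VS by apply/FadjoinP; rewrite sub1v.
by move/field_dimS; rewrite dim_Fadjoin dimv1 muln1.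
Qed.

(** From U to k, the characteristic polynomial is defined over k, so minPoly U t
descends, and t lies in V because its degree over k divides \dim V. From k to
U, the degree of t over k divides \dim V, hence is prime to \dim U. *)
Lemma cuspidal_root_base_change U V t :
  \dim V = n.+1 -> coprime (\dim U) (\dim V) ->
  cuspidal_root U {:L}%AS t <-> cuspidal_root 1%AS V t.
Proof.
move=> dimV cop; split=> [Ut | [Vt t0 charE]]; last first.
  have mE := minPoly_coprime_dim cop Vt.
  by split; rewrite ?memvf // (adjoin_degree_minPoly mE) mE.
have [_ t0 charE] := Ut.
have mE : minPoly U t = minPoly 1 t.
  apply: minPoly_descent (sub1v _) (cuspidal_root_exp_gt0 Ut) _.
  rewrite -charE; exact: char_poly_polyOver1.
have dE := adjoin_degree_minPoly mE.
split=> //; last by rewrite -mE -dE.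
suffices /subvP : (<<1%AS; t>> <= V)%VS by apply; apply: memv_adjoin.
apply: subv_dvd_dim; rewrite dim_Fadjoin dimv1 muln1 -dE dimV.
exact: cuspidal_root_degree Ut.
Qed.

Lemma cuspidal_root_root U V s t :
  cuspidal_root U V s -> cuspidal_root U V t -> root (minPoly U t) s.
Proof.
move=> s_root t_root; have [_ _ charE] := t_root.
have M_gt0 := cuspidal_root_exp_gt0 t_root.
have : root (char_poly xL) s.
  have [_ _ ->] := s_root.
  rewrite root_exp ?root_minPoly ?(cuspidal_root_exp_gt0 s_root) //.
  exact: mulrC.
by rewrite charE root_exp //; exact: mulrC.
Qed.

Lemma cuspidal_root_minPoly U V s t :
  cuspidal_root U V s -> cuspidal_root U V t -> minPoly U s = minPoly U t.
Proof.
move=> s_root t_root; apply/eqP; rewrite -eqp_monic ?monic_minPoly // /eqp.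
by rewrite !minPoly_dvdp ?minPolyOver ?(cuspidal_root_root s_root)
           ?(cuspidal_root_root t_root).
Qed.

Lemma mult_characterX (R : comNzRingType) V (theta : L -> R) y m :
  mult_character V theta -> y \in V -> y != 0 -> theta (y ^+ m) = theta y ^+ m.
Proof.
move=> [theta1 thetaM] Vy y0; elim: m => [|m IHm]; first by rewrite !expr0.
by rewrite !exprS thetaM ?rpredX ?expf_neq0 // IHm.
Qed.

Lemma expf_Fadjoin U t : t ^+ ((#|k| ^ \dim U) ^ adjoin_degree U t) = t.
Proof.
apply/eqP; rewrite -expnM mulnC -dim_Fadjoin -Fermat's_little_theorem.
exact: memv_adjoin.
Qed.

(** Over U the conjugates of s = t ^ (q ^ j) are the t ^ (q ^ (j + l * i)), for
q = #|k| and l = \dim U, and phi maps each of them to the l-th power of its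
image under psi. The l-th power map on F is a ring morphism which fixes the
images of integers, so it matches the remaining factors. *)
Lemma cuspidal_value_frobenius (R : comNzRingType) (F : fieldType)
    (red : {rmorphism R -> F}) U V (phi psi : L -> R) s t :
  \dim U \in [pchar F] -> \dim V = n.+1 -> coprime (\dim U) (\dim V) ->
  mult_character V psi ->
  {in V, forall y, y != 0 -> phi y = psi (y ^+ \dim U)} ->
  cuspidal_root 1%AS V s -> cuspidal_root 1%AS V t ->
  red (cuspidal_value_at U phi s) =
  red (cuspidal_value_at 1%AS psi t) ^+ \dim U.
Proof.
move=> l_char dimV cop psi_char phiE s_root t_root.
have [Vs s0 _] := s_root; have [Vt t0 _] := t_root.
have m_Us := minPoly_coprime_dim cop Vs.
have m_st := cuspidal_root_minPoly s_root t_root.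
have [j sE] := minPoly_conj (cuspidal_root_root s_root t_root).
have m_Ut : minPoly U s = minPoly 1 t by rewrite m_Us.
rewrite /cuspidal_value_at dimv1 expn1 m_Ut (adjoin_degree_minPoly m_Ut).
set d := adjoin_degree 1 t; set r := (_ %/ d)%N.
set l := \dim U in l_char cop phiE *.
pose frob : {rmorphism F -> F} := pFrobenius_aut l_char.
rewrite -[RHS]/(frob _) !rmorphM !rmorphXn !rmorphN !rmorph1; congr (_ * _ * _).
  have td i : psi (t ^+ (#|k| ^ (i %% d))) = psi (t ^+ (#|k| ^ i)).
    rewrite [in RHS](divn_eq i d) expnD exprM [(_ * d)%N]mulnC.
    have := expf_Fadjoin 1 t; rewrite dimv1 expn1 => /(expf_iter_id (i %/ d)).
    by rewrite -/d => ->.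
  rewrite !rmorph_sum /=.
  have cop_d : coprime l d.
    apply: coprime_dvdr cop; rewrite dimV.
    exact: cuspidal_root_degree t_root.
  pose G i := frob (red (psi (t ^+ (#|k| ^ i)))).
  rewrite -(@eq_sum_coprime_reindex _ G d l j) //.
  - apply: eq_bigr => i _; rewrite sE dimv1 expn1 -expnM -exprM -expnD.
    rewrite phiE ?rpredX ?expf_neq0 //.
    rewrite (mult_characterX _ psi_char) ?rpredX ?expf_neq0 //.
    by rewrite rmorphXn /=.
  - by move=> i; rewrite /G td.
rewrite !rmorph_prod; apply: eq_bigr => i _.
rewrite !rmorphB !rmorph1 !rmorph_nat; congr (1 - _).
by rewrite !natrX -[X in X ^+ _ = _]/(frob _) rmorph_nat.
Qed.

End CuspidalValues.

(* Rank n.+1, i.e. the integer n >= 1 of the usual statement is n.+1 here. *)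
Theorem theorem11
    (* the field k of characteristic p, and the prime l *)
    (k : finFieldType) (p l n : nat)
    (p_char : p \in [pchar k]) (l_prime : prime l) (l_neq_p : l != p)
    (* L = k_{l(n+1)}, with its subfields kl = k_l and kn = k_{n+1} *)
    (L : splittingFieldType k) (dimL : \dim {: L} = (l * n.+1)%N)
    (kl kn : {subfield L}) (dim_kl : \dim kl = l) (dim_kn : \dim kn = n.+1)
    (* the algebraic closure of Q_l, and reduction modulo the maximal ideal *)
    (Qlbar : closedFieldType) (iota : {rmorphism padic l_prime -> Qlbar})
    (Qlbar_closure : is_algebraic_closure iota)
    (Flbar : fieldType) (red : {rmorphism integral_closure iota -> Flbar})
    (red_surj : forall a : Flbar, exists z : integral_closure iota, red z = a)
    (* the characters phi and psi *)
    (phi psi : L -> integral_closure iota)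
    (phi_regular : regular_character kl {:L}%AS phi)
    (psi_regular : regular_character 1%AS kn psi)
    (phi_norm : forall y : L, y != 0 -> phi y = psi (galNorm kn {:L} y))
    (x : 'M[k]_n.+1) (x_unit : x \in unitmx) :
  red (cuspidal_character {:L}%AS phi (map_mx (in_alg (subvs_of kl)) x)) =
  red (cuspidal_character kn psi
         (map_mx (in_alg (subvs_of (1%AS : {subfield L}))) x)) ^+ l.
Proof.
have mn : \dim_kn {:L} = l by rewrite dimL dim_kn mulnK.
have cop : coprime (\dim kl) (\dim kn).
  by apply: coprime_dim_of_regular_norm phi_regular phi_norm; rewrite mn.
have dim_klF : \dim kl \in [pchar Flbar].
  by rewrite dim_kl; apply: residue_pchar red_surj.
have phiE : {in kn, forall y, y != 0 -> phi y = psi (y ^+ \dim kl)}.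
  move=> y kn_y y0; rewrite phi_norm // galNorm_base ?mn ?dim_kl //.
  exact: finField_galois (subvf kn).
have [psi_char _] := psi_regular; pose k1 := 1%AS : {subfield L}.
have rootE t := cuspidal_root_base_change x t dim_kn cop.
rewrite /cuspidal_character; case: classical_sets.xgetP => [v _ | no_v].
  move=> /cuspidal_valueP[s /rootE s_root ->].
  case: classical_sets.xgetP => [w _ /cuspidal_valueP[t t_root ->] | no_w].
    by rewrite -[X in _ ^+ X]dim_kl; apply: cuspidal_value_frobenius t_root.
  case: (no_w (cuspidal_value_at x k1 psi s)).
  by apply/cuspidal_valueP; exists s.
case: classical_sets.xgetP => [w _ /cuspidal_valueP[t /rootE t_root _] | _].
  case: (no_v (cuspidal_value_at x kl phi t)).
  by apply/cuspidal_valueP; exists t.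
(* Neither character has a prescribed value at x, so both take the default 0. *)
by rewrite !rmorph0 expr0n eqn0Ngt prime_gt0.
Qed.
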